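(* Let $(a,b)\in\mathcal H$ and $\phi=\phi_{a,b}$. The following are equivalent: (a) $(a,b)\in\mathcal H_{\mathrm I}$; (b) $J(\phi)=B_1(0,0)$; (c) $J^+(\phi)=B_1(0,0)$; (d) $J^-(\phi)=B_1(0,0)$; (e) $\phi(B_1(0,0))=B_1(0,0)$.
   Context: $K$ is a field complete and locally compact with respect to a nontrivial non-Archimedean absolute value $|\cdot|$, whose residue field has odd characteristic. $\|(x,y)\|=\max(|x|,|y|)$, $B_1(0,0)=\{(x,y)\in K^2:\|(x,y)\|\le1\}$. $\mathcal H=\{(a,b)\in K^2:b\ne0\}$, $\phi_{a,b}(x,y)=(a+by-x^2,x)$, a bijection with inverse $(x,y)\mapsto(y,\frac1b(-a+x+y^2))$. $J^+(\phi)$ (resp. $J^-(\phi)$) is the set of $(x,y)$ with $\|\phi^n(x,y)\|$ bounded as $n\to+\infty$ (resp. $n\to-\infty$); $J(\phi)=J^+(\phi)\cap J^-(\phi)$. $\mathcal H_{\mathrm I}=\{(a,b)\in\mathcal H:|a|\le1,|b|=1\}$. *)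

(* Defs.v *)
From HB Require Import structures.
From mathcomp Require Import all_boot all_order all_algebra.
From mathcomp Require Import all_classical all_reals all_analysis.

Set Implicit Arguments.
Unset Strict Implicit.
Unset Printing Implicit Defensive.

Import Order.TTheory GRing.Theory Num.Theory.

Local Open Scope classical_set_scope.
Local Open Scope ring_scope.
Local Open Scope quotient_scope.

(* The norms of MathComp (normedZmodType) satisfy `|x *+ n| = `|x| *+ n and are
   therefore Archimedean, which is why absolute values are introduced here. *)
Record nonarchAbs (R : realType) (K : fieldType) := NonarchAbs {
  absv :> K -> R;
  absv_ge0 : forall x, 0 <= absv x;
  absv_eq0 : forall x, absv x = 0 <-> x = 0;
  absvM : forall x y, absv (x * y) = absv x * absv y;
  absv_ultra : forall x y, absv (x + y) <= Num.max (absv x) (absv y) }.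

Definition nontrivial_abs (R : realType) (K : fieldType)
  (v : nonarchAbs R K) : Prop := exists2 x : K, x != 0 & v x != 1.

Section AbsTheory.
Variables (R : realType) (K : fieldType) (v : nonarchAbs R K).

Lemma absv0 : v 0 = 0. Proof. exact/absv_eq0. Qed.

Lemma absv1 : v 1 = 1.
Proof.
have v1 : v 1 != 0 by apply/eqP => /absv_eq0/eqP; rewrite oner_eq0.
by apply: (mulfI v1); rewrite -absvM !mulr1.
Qed.

Lemma absvN x : v (- x) = v x.
Proof.
suff vN1 : v (-1) = 1 by rewrite -mulN1r absvM vN1 mul1r.
apply/eqP; have := absvM v (-1) (-1).
rewrite mulrNN mulr1 absv1 => /esym/eqP; rewrite -expr2 sqrf_eq1 => /orP[//|].
by move=> /eqP h; have := absv_ge0 v (-1); rewrite h oppr_ge0 ler10.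
Qed.

Lemma absv_distC x y : v (x - y) = v (y - x).
Proof. by rewrite -absvN opprB. Qed.

End AbsTheory.

(* K with the metric |x - y|. *)
Definition abs_space (R : realType) (K : fieldType) (v : nonarchAbs R K) : Type
  := K.

Section AbsSpace.
Variables (R : realType) (K : fieldType) (v : nonarchAbs R K).

HB.instance Definition _ := Choice.copy (abs_space v) K.
HB.instance Definition _ := isPointed.Build (abs_space v) (0 : K).

Let dist (x y : abs_space v) : R := v ((x : K) - (y : K)).

Let distxx x : dist x x = 0.
Proof. by rewrite /dist subrr absv0. Qed.

Let dist_positivity x y : dist x y = 0 -> x = y.
Proof. by move=> /absv_eq0/eqP; rewrite subr_eq0 => /eqP. Qed.

Let dist_sym x y : dist x y = dist y x.
Proof. exact: absv_distC. Qed.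

Let dist_triangle y x z : dist x z <= dist x y + dist y z.
Proof.
rewrite /dist -(subrKA (y : K)) (le_trans (absv_ultra _ _ _))//.
by rewrite ge_max lerDl lerDr !absv_ge0.
Qed.

HB.instance Definition _ := @isMetric.Build R (abs_space v) dist
  distxx dist_positivity dist_sym dist_triangle.

End AbsSpace.

Definition complete_abs (R : realType) (K : fieldType) (v : nonarchAbs R K)
  : Prop :=
  forall F : set_system (abs_space v), ProperFilter F -> cauchy F -> cvg F.

Definition locally_compact_abs (R : realType) (K : fieldType)
  (v : nonarchAbs R K) : Prop := locally_compact [set: abs_space v].

Definition val_ring_pred (R : realType) (K : fieldType) (v : nonarchAbs R K)
  : pred K := fun x => v x <= 1.

Section ValRingPred.
Variables (R : realType) (K : fieldType) (v : nonarchAbs R K).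

Let val_ring_closed : subring_closed (val_ring_pred v).
Proof.
split=> [|x y|x y]; rewrite /in_mem /= /val_ring_pred ?absv1// => vx vy.
  by rewrite (le_trans (absv_ultra _ _ _))// ge_max vx absvN.
by rewrite absvM mulr_ile1// absv_ge0.
Qed.

HB.instance Definition _ :=
  GRing.isSubringClosed.Build K (val_ring_pred v) val_ring_closed.

End ValRingPred.

Record val_ring (R : realType) (K : fieldType) (v : nonarchAbs R K) := ValRing {
  val_ring_val :> K;
  _ : val_ring_val \in val_ring_pred v }.

Section ValRing.
Variables (R : realType) (K : fieldType) (v : nonarchAbs R K).

HB.instance Definition _ := [isSub of val_ring v for @val_ring_val R K v].
HB.instance Definition _ := [Choice of val_ring v by <:].
HB.instance Definition _ := [SubChoice_isSubComNzRing of val_ring v by <:].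

End ValRing.

Definition max_ideal (R : realType) (K : fieldType) (v : nonarchAbs R K)
  : pred (val_ring v) := fun x => v (val x) < 1.

Arguments max_ideal {R K} v _.

Section MaxIdeal.
Variables (R : realType) (K : fieldType) (v : nonarchAbs R K).

Let max_ideal_closed : idealr_closed (max_ideal v).
Proof.
rewrite /idealr_closed /in_mem /= /max_ideal /=; split.
- by rewrite absv0.
- by rewrite absv1 ltxx.
- move=> a x y vx vy; rewrite (le_lt_trans (absv_ultra _ _ _))// gt_max.
  apply/andP; split=> //; rewrite absvM.
  by rewrite (le_lt_trans _ vx)// ler_piMl ?absv_ge0//; exact: valP a.
Qed.

HB.instance Definition _ := isIdealr.Build (val_ring v) (max_ideal v)
  max_ideal_closed.

End MaxIdeal.

Definition residue_field (R : realType) (K : fieldType) (v : nonarchAbs R K)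
  : comNzRingType := {ideal_quot (max_ideal v : idealr (val_ring v))}.

Lemma residue_fieldP (R : realType) (K : fieldType) (v : nonarchAbs R K)
  : forall x : residue_field v, x != 0 -> exists y, x * y = 1.
Proof.
pose Q := {ideal_quot (max_ideal v : idealr (val_ring v))}.
change (forall x : Q, x != 0 -> exists y : Q, x * y = 1).
elim/quotW => u; rewrite !piE Quotient.equivE subr0 => u_notin.
have vu_ge1 : 1 <= v (val u) by rewrite leNgt; exact: u_notin.
have vu : v (val u) = 1 by apply/eqP; rewrite eq_le vu_ge1 andbT; exact: valP u.
have u0 : val u != 0
  by apply/eqP => u0; move/eqP: vu; rewrite u0 absv0 eq_sym oner_eq0.
have vV : (val u)^-1 \in val_ring_pred v.
  rewrite /in_mem /= /val_ring_pred -[leLHS]mul1r -[X in X * _]vu -absvM.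
  by rewrite mulfV// absv1.
exists (\pi_Q (ValRing vV)); apply/eqP; rewrite !piE Quotient.equivE.
suff -> : u * ValRing vV = 1 by rewrite subrr rpred0.
by apply: val_inj; rewrite /= mulfV.
Qed.

Definition odd_residue_char (R : realType) (K : fieldType)
  (v : nonarchAbs R K) : Prop :=
  exists2 p : nat, p \in [pchar (residue_field v)] & odd p.

Definition max_norm (R : realType) (K : fieldType) (v : nonarchAbs R K)
  (z : K * K) : R := Num.max (v z.1) (v z.2).

Definition unit_ball (R : realType) (K : fieldType) (v : nonarchAbs R K)
  : set (K * K) := [set z | max_norm v z <= 1].

Section Henon.
Variable K : fieldType.

Definition paramH : set (K * K) := [set ab | ab.2 != 0].

Definition henon (ab z : K * K) : K * K :=
  (ab.1 + ab.2 * z.2 - z.1 ^+ 2, z.1).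

Definition henon_inv (ab z : K * K) : K * K :=
  (z.2, ab.2^-1 * (- ab.1 + z.1 + z.2 ^+ 2)).

Lemma henonK (ab : K * K) : paramH ab -> cancel (henon ab) (henon_inv ab).
Proof.
move=> b0 [x y]; rewrite /henon /henon_inv /=; congr pair.
by rewrite addrA addKr subrK mulKf.
Qed.

Lemma henon_invK (ab : K * K) : paramH ab -> cancel (henon_inv ab) (henon ab).
Proof.
move=> b0 [x y]; rewrite /henon /henon_inv /=; congr pair.
by rewrite mulVKf// -!addrA addrN addr0 addNKr.
Qed.

End Henon.

Section Julia.
Variables (R : realType) (K : fieldType) (v : nonarchAbs R K).

Definition paramHI : set (K * K) :=
  [set ab | [/\ paramH ab, v ab.1 <= 1 & v ab.2 = 1]].

Definition bounded_orbit (f : K * K -> K * K) (z : K * K) : Prop :=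
  has_ubound (range (fun n => max_norm v (iter n f z))).

Definition Jplus (ab : K * K) : set (K * K) :=
  [set z | bounded_orbit (henon ab) z].

Definition Jminus (ab : K * K) : set (K * K) :=
  [set z | bounded_orbit (henon_inv ab) z].

Definition Jset (ab : K * K) : set (K * K) := Jplus ab `&` Jminus ab.

End Julia.

(* Main.v *)
(* Each of J, J+, J- is invariant under phi, so its being the unit ball B gives
   phi(B) = B, and the images and preimages of (0,0), (0,1), (1,0) then force
   |a| <= 1 = |b|. Conversely, for such (a,b) both phi and its inverse preserve
   B. Outside B, a point with |y| <= |x| escapes since |x| is squared at each
   step, while an orbit staying in |x| < |y| would yield values
   |y|^(1/2^n) > 1 of the absolute value, which is discrete by local
   compactness. *)
Require Import Defs.
From mathcomp Require Import all_boot all_order all_algebra.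
From mathcomp Require Import all_classical all_reals all_analysis.
From mathcomp Require Import ring.

Import Order.TTheory GRing.Theory Num.Theory.

Local Open Scope classical_set_scope.
Local Open Scope ring_scope.

(** * Geometric growth *)

Lemma bernoulli_ge (R : realDomainType) (d : R) n :
  0 <= d -> 1 + d *+ n <= (1 + d) ^+ n.
Proof.
move=> d0; elim: n => [|n IH]; first by rewrite mulr0n addr0 expr0.
rewrite exprS mulrDl mul1r mulrS addrCA addrC lerD// ler_peMr//.
by rewrite (le_trans _ IH)// lerDl mulrn_wge0.
Qed.

Lemma expr_unbounded (R : archiRealFieldType) (d M : R) :
  1 < d -> exists n, M < d ^+ n.
Proof.
rewrite -subr_gt0 => d1; exists (Num.Def.archi_bound (`|M| / (d - 1))).
have := archi_boundP (divr_ge0 (normr_ge0 M) (ltW d1)).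
rewrite ltr_pdivrMr// mulr_natl => Mlt.
rewrite (le_lt_trans (ler_norm M))// (lt_le_trans Mlt)//.
have := @bernoulli_ge _ (d - 1) (Num.Def.archi_bound (`|M| / (d - 1))) (ltW d1).
by rewrite subrKC; apply: le_trans; rewrite lerDr.
Qed.

(** * Ultrametric estimates and discreteness of the absolute value *)

Section NonarchAbs.
Context {R : realType} {K : fieldType} (v : nonarchAbs R K).
Implicit Types x y : K.

Lemma absvX x n : v (x ^+ n) = v x ^+ n.
Proof. by elim: n => [|n IH]; rewrite ?expr0 ?absv1// !exprS absvM IH. Qed.

Lemma absv_gt0 x : x != 0 -> 0 < v x.
Proof.
move=> x0; rewrite lt_neqAle absv_ge0 andbT eq_sym.
by apply: contraNneq x0 => /absv_eq0 ->.
Qed.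

Lemma absvV x : x != 0 -> v x^-1 = (v x)^-1.
Proof.
move=> x0; apply: (mulfI (lt0r_neq0 (absv_gt0 _ x0))).
by rewrite -absvM divff// absv1 divff// lt0r_neq0// absv_gt0.
Qed.

(** Writing x as (x + y) - y bounds |x| by max(|x + y|, |y|), and |y| < |x| rules out the second
    term. *)
Lemma absvD_eq x y : v y < v x -> v (x + y) = v x.
Proof.
move=> yx; apply/eqP; rewrite eq_le; apply/andP; split.
  by rewrite (le_trans (absv_ultra _ _ _))// ge_max lexx ltW.
have := absv_ultra v (x + y) (- y); rewrite addrK absvN le_max => /orP[//|].
by rewrite leNgt yx.
Qed.

Lemma absvD_le x y (M : R) : v x <= M -> v y <= M -> v (x + y) <= M.
Proof. by move=> xM yM; rewrite (le_trans (absv_ultra _ _ _))// ge_max xM. Qed.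

Lemma absv_near_eq x y : v (x - y) < v y -> v x = v y.
Proof. by move=> /absvD_eq; rewrite addrC subrK. Qed.

(** Powers of some u with 0 < |u| < 1 tend to 0; nontriviality gives such a u, after inversion if
    need be. *)
Lemma absv_small : nontrivial_abs v ->
  forall e : R, 0 < e -> exists2 c, c != 0 & v c < e.
Proof.
have [small|] := pselect (exists2 u, u != 0 & v u < 1); last first.
  move=> none [x x0 x1]; exfalso; apply: none.
  have [?|] := ltP (v x) 1; first by exists x.
  rewrite le_eqVlt eq_sym (negbTE x1)/= => vx.
  by exists x^-1; rewrite ?invr_eq0// absvV// invf_lt1// absv_gt0.
case: small => u u0 u1 _ e e0.
have [n en] : exists n, e^-1 < (v u)^-1 ^+ n.
  by apply: expr_unbounded; rewrite invf_gt1// absv_gt0.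
exists (u ^+ n); first exact: expf_neq0.
by rewrite absvX -(invrK (_ ^+ n)) -exprVn invf_plt ?posrE ?exprn_gt0 ?invr_gt0
  ?absv_gt0.
Qed.

(* Otherwise the elements with 1 < |x| < d, scaled into a compact neighbourhood
   of 0, cluster at some w as d decreases to 1; their absolute values, which are
   locally constant away from 0, would all equal |w|. *)
Lemma absv_gap : nontrivial_abs v -> locally_compact_abs v ->
  exists2 d : R, 1 < d & forall x, 1 < v x -> d <= v x.
Proof.
move=> nt lc; apply: contrapT => nogap.
have H (d : R) : 1 < d -> exists2 x, 1 < v x & v x < d.
  move=> d1; apply: contrapT => none; apply: nogap; exists d => // x x1.
  by rewrite leNgt; apply/negP => xd; apply: none; exists x.
have := lc (0 : K) I; rewrite withinET => -[U /nbhs_ballP[e /= e0 eU] [cU _]].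
(* With |c| < e / 2, every x with |x| < 2 satisfies |c x| < e, so [A 2] lies in [U]. *)
have [c c0 ce] := absv_small nt (e / 2) (divr_gt0 e0 (ltr0Sn _ _)).
pose A (d : R) : set (abs_space v) := [set c * x | x in [set x | 1 < v x < d]].
pose F := filter_from [set d : R | 1 < d] A.
have FF : ProperFilter F.
  apply: filter_from_proper => [|d /H[x x1 xd]]; last first.
    by exists (c * x), x => //=; rewrite x1.
  apply: filter_from_filter; first by exists 2; rewrite /= ltr1n.
  move=> i j /= i1 j1; exists (Num.min i j); first by rewrite /= lt_min i1.
  by move=> _ [x /= + <-]; rewrite lt_min => /and3P[x1 xi xj]; split;
    exists x => //=; rewrite x1.
have FA d : 1 < d -> F (A d) by exists d.
have FU : F U.
  exists 2; rewrite /= ?ltr1n// => _ [x /= /andP[x1 x2] <-]; apply: eU.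
  rewrite ballEmdist/= /mdist/= sub0r absvN absvM.
  have -> : e = e / 2 * 2 by rewrite divfK.
  by rewrite ltr_pM ?absv_ge0.
have [w [_ wF]] := cU F FF FU.
(* The cluster point w has a point c x of [A d] within distance |c| < |c x|, which forces |w| = |c
   x|. *)
have near d : 1 < d -> exists2 x, 1 < v x < d & v w = v (c * x).
  move=> d1; have := wF _ _ (FA _ d1) (nbhsx_ballx w _ (absv_gt0 _ c0)).
  case=> _ [[x /= xd <-]]; rewrite ballEmdist/= /mdist/= => wx.
  exists x => //; apply: absv_near_eq; rewrite (lt_trans wx)// absvM.
  by rewrite ltr_pMr ?absv_gt0//; case/andP: xd.
have [x /andP[x1 _] wx] := near 2 (ltr1n _ _).
(* Taking d = |x| gives |y| < |x|, although |c y| = |w| = |c x|. *)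
have [y /andP[y1 yx] wy] := near _ x1.
move: wy; rewrite wx !absvM => /(mulfI (lt0r_neq0 (absv_gt0 _ c0))) xy.
by move: yx; rewrite xy ltxx.
Qed.

End NonarchAbs.

(* Covers phi_{a,b} and, after exchanging the coordinates, its inverse. *)
Definition henon_like {K : fieldType} (p q r : K) (z : K * K) : K * K :=
  (p + q * z.2 + r * z.1 ^+ 2, z.1).

(** * Dynamics of quadratic maps with unit coefficients *)

Section HenonLike.
Context {R : realType} {K : fieldType} (v : nonarchAbs R K) {p q r : K}.
Hypotheses (p1 : v p <= 1) (q1 : v q = 1) (r1 : v r = 1).
Let f := henon_like p q r.

Lemma henon_like_ball z : max_norm v z <= 1 -> max_norm v (f z) <= 1.
Proof.
rewrite /max_norm !ge_max /= => /andP[x1 y1]; rewrite x1 andbT.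
by rewrite !absvD_le// absvM ?q1 ?r1 mul1r// absvX exprn_ile1// absv_ge0.
Qed.

(** As |q| = 1, the lost coordinate [z.2] can be solved for from [f z], so a point whose image is in
    the ball is itself in the ball. *)
Lemma henon_like_notin_ball z : 1 < max_norm v z -> 1 < max_norm v (f z).
Proof.
rewrite !ltNge; apply: contra; rewrite /max_norm !ge_max /= => /andP[fz x1].
rewrite x1/=; have -> : v z.2 = v (q * z.2) by rewrite absvM q1 mul1r.
have -> : q * z.2 = (p + q * z.2 + r * z.1 ^+ 2) - (p + r * z.1 ^+ 2)
  by ring.
rewrite absvD_le// absvN absvD_le// absvM r1 mul1r absvX exprn_ile1//.
exact: absv_ge0.
Qed.

Lemma henon_like_dominant z : 1 < v z.1 -> v z.2 <= v z.1 ->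
  v (f z).1 = v z.1 ^+ 2.
Proof.
move=> x1 yx; have xx : v z.1 < v z.1 ^+ 2.
  by rewrite expr2 ltr_pMr// (lt_trans ltr01).
rewrite /= addrC absvD_eq absvM r1 mul1r absvX//.
rewrite (le_lt_trans _ xx)// absvD_le//; first by rewrite (le_trans p1)// ltW.
by rewrite absvM q1 mul1r.
Qed.

Lemma henon_like_escape z : 1 < v z.1 -> v z.2 <= v z.1 ->
  ~ bounded_orbit v f z.
Proof.
move=> x1 yx [M /= Mub].
have x0 : 0 < v z.1 := lt_trans ltr01 x1.
(* The squaring is weakened to a factor |x_0| per step, which already gives unboundedness; the
   second conjunct keeps the quadratic term dominant. *)
have growth n : v z.1 ^+ n.+1 <= v (iter n f z).1 /\
    v (iter n f z).2 <= v (iter n f z).1.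
  elim: n => [|n [IH1 IH2]]; first by rewrite expr1.
  set w := iter n f z in IH1 IH2 *.
  have zw : v z.1 <= v w.1.
    by rewrite (le_trans _ IH1)// exprS ler_pMr// exprn_ege1// ltW.
  have w1 := lt_le_trans x1 zw; have w0 := lt_trans ltr01 w1.
  rewrite iterS henon_like_dominant//; split.
    by rewrite exprS expr2 ler_pM// ?exprn_ge0// ltW.
  by rewrite expr2 ler_pMr// ltW.
have [n Mn] := expr_unbounded _ _ M x1.
have := Mub _ (ex_intro2 _ _ n I erefl); rewrite leNgt => /negP; apply.
rewrite lt_max (lt_le_trans Mn)// (le_trans _ (proj1 (growth n)))//.
by rewrite exprS ler_peMl ?exprn_ge0// ltW.
Qed.

(* An orbit outside the ball that never escapes keeps |x_n| < |y_n|, hence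
   |y_n| = |y_(n+1)|^2 with all |y_n| > 1, so y_0 is arbitrarily large. *)
Lemma bounded_orbit_ball (d : R) : 1 < d -> (forall x, 1 < v x -> d <= v x) ->
  forall z, bounded_orbit v f z -> max_norm v z <= 1.
Proof.
move=> d1 gap z bz; rewrite leNgt; apply/negP => z1.
have bounded_iter n : bounded_orbit v f (iter n f z).
  case: bz => M Mub; exists M => _ [m _ <-]; apply: Mub.
  by exists (m + n)%N => //; rewrite iterD.
have out n : 1 < max_norm v (iter n f z).
  by elim: n => [//|n IH]; rewrite iterS henon_like_notin_ball.
have slope n : v (iter n f z).1 < v (iter n f z).2.
  rewrite ltNge; apply/negP => yx.
  apply: (henon_like_escape _ _ yx (bounded_iter n)).
  by have := out n; rewrite /max_norm max_l.
have big n : 1 < v (iter n f z).2.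
  by have := out n; rewrite /max_norm max_r// ltW.
have step n : v (iter n f z).2 = v (iter n.+1 f z).2 ^+ 2.
  have := slope n.+1; have := big n.+1; rewrite iterS /=.
  set w := iter n f z => x1 small.
  have -> : v w.2 = v (q * w.2) by rewrite absvM q1 mul1r.
  have xx : v w.1 < v w.1 ^+ 2 by rewrite expr2 ltr_pMr// (lt_trans ltr01).
  have pr : v (r * w.1 ^+ 2 + p) = v w.1 ^+ 2.
    rewrite absvD_eq absvM r1 mul1r absvX//.
    by rewrite (le_lt_trans p1)// exprn_egt1.
  (* Here q y_n = x_(n+1) - (r x_n^2 + p), and x_(n+1) is negligible: |x_(n+1)| < |y_(n+1)| = |x_n|
     < |x_n|^2. *)
  rewrite -pr -[RHS]absvN -[RHS](absvD_eq v _ (p + q * w.2 + r * w.1 ^+ 2)).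
    by congr (v _); ring.
  by rewrite absvN pr (lt_trans small).
(* The gap turns |y_n| = |y_(n+1)|^2 into |y_n| >= d |y_(n+1)|. *)
have far n : d ^+ n * v (iter n f z).2 <= v z.2.
  elim: n => [|n]; first by rewrite mul1r.
  apply: le_trans; rewrite (step n) exprSr -mulrA ler_wpM2l ?exprn_ge0//.
    exact: le_trans ler01 (ltW d1).
  by rewrite expr2 ler_wpM2r ?absv_ge0// gap.
have [n] := expr_unbounded _ _ (v z.2) d1.
rewrite ltNge => /negP; apply; apply: (le_trans _ (far n)).
by rewrite ler_peMr ?exprn_ge0 ?(le_trans ler01) ?ltW.
Qed.

Lemma henon_like_bounded_orbit (d : R) :
  1 < d -> (forall x, 1 < v x -> d <= v x) ->
  forall z, bounded_orbit v f z <-> max_norm v z <= 1.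
Proof.
move=> d1 gap z; split; first exact: (bounded_orbit_ball d).
move=> z1; exists 1 => _ [n _ <-].
by elim: n => // n; exact: henon_like_ball.
Qed.

End HenonLike.

(** * Invariance of the filled Julia sets, and the parameters it forces *)

Section Orbits.
Context {R : realType} {K : fieldType} (v : nonarchAbs R K).
Implicit Types f g : K * K -> K * K.

Lemma bounded_orbit_step f z : bounded_orbit v f (f z) <-> bounded_orbit v f z.
Proof.
split=> -[M Mub].
  exists (Num.max M (max_norm v z)) => _ [[|n] _ <-];
    rewrite le_max ?lexx ?orbT//.
  by apply/orP; left; apply: Mub; exists n => //; rewrite -iterSr.
by exists M => _ [n _ <-]; apply: Mub; exists n.+1 => //; rewrite iterSr.
Qed.

Lemma bounded_orbit_swap f g :
  (forall z, f (swap_pair z) = swap_pair (g z)) ->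
  forall z, bounded_orbit v f (swap_pair z) <-> bounded_orbit v g z.
Proof.
move=> fg z; rewrite /bounded_orbit.
suff -> : (fun n => max_norm v (iter n f (swap_pair z))) =
          (fun n => max_norm v (iter n g z)) by [].
apply/funext => n; suff -> : iter n f (swap_pair z) = swap_pair (iter n g z).
  by rewrite /max_norm /= maxC.
by elim: n => // n IH; rewrite !iterS IH fg.
Qed.

Lemma image_invariant f g (A : set (K * K)) : cancel g f ->
  (forall z, A (f z) <-> A z) -> f @` A = A.
Proof.
move=> gf Af; apply/seteqP; split=> [_ [z /Af Az <-]//|z Az].
by exists (g z); rewrite ?gf//; apply/Af; rewrite gf.
Qed.

Context {ab : K * K} (abH : paramH ab).

Lemma henon_image_Jplus : henon ab @` Jplus v ab = Jplus v ab.
Proof.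
exact: image_invariant (henon_invK abH) (bounded_orbit_step (henon ab)).
Qed.

(** The backward orbit of [henon ab z] is that of [z] preceded by one point. *)
Lemma henon_image_Jminus : henon ab @` Jminus v ab = Jminus v ab.
Proof.
apply: image_invariant (henon_invK abH) _ => z.
by rewrite /Jminus /= -bounded_orbit_step henonK.
Qed.

Lemma henon_image_Jset : henon ab @` Jset v ab = Jset v ab.
Proof.
apply: image_invariant (henon_invK abH) _ => z.
by rewrite /Jset /Jplus /Jminus /= bounded_orbit_step
  -(bounded_orbit_step (henon_inv ab)) henonK.
Qed.

Lemma image_unit_ball_paramHI :
  henon ab @` unit_ball v = unit_ball v -> paramHI v ab.
Proof.
move=> fB.
have fB_in z : max_norm v z <= 1 -> max_norm v (henon ab z) <= 1.
  by move=> zB; suff : unit_ball v (henon ab z) by []; rewrite -fB; exists z.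
have gB_in z : max_norm v z <= 1 -> max_norm v (henon_inv ab z) <= 1.
  move=> zB; have : unit_ball v z by [].
  by rewrite -fB => -[w wB <-]; rewrite henonK.
(* The images are (a, 0) and (a + b, 0), the preimages (0, -a/b) and (0, (1 - a)/b); differences
   isolate b and 1/b. *)
have f00 := fB_in (0, 0); have f01 := fB_in (0, 1).
have g00 := gB_in (0, 0); have g10 := gB_in (1, 0).
move: f00 f01 g00 g10; rewrite /max_norm /= !ge_max !absv0 !absv1 !ler01 !lexx /=.
rewrite !expr0n !mulr0 !mulr1 !addr0 !subr0 !andbT.
move=> /(_ isT) a1 /(_ isT) ab1 /(_ isT) ba1 /(_ isT) ba11.
split=> //; apply/eqP; rewrite eq_le; apply/andP; split.
  have -> : ab.2 = (ab.1 + ab.2) - ab.1 by rewrite addrC addKr.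
  by rewrite absvD_le// absvN.
rewrite -invf_le1 ?absv_gt0// -absvV//.
have -> : ab.2^-1 = ab.2^-1 * (- ab.1 + 1) - ab.2^-1 * - ab.1 by ring.
by rewrite absvD_le// absvN.
Qed.

Lemma paramHI_Jplus (d : R) : 1 < d -> (forall x, 1 < v x -> d <= v x) ->
  paramHI v ab -> Jplus v ab = unit_ball v.
Proof.
move=> d1 gap [_ a1 b1]; apply/seteqP.
have fE : henon ab = henon_like ab.1 ab.2 (-1).
  by apply/funext => z; rewrite /henon_like mulN1r.
have N1 : v (-1) = 1 by rewrite absvN absv1.
by split=> z; rewrite /Jplus /unit_ball /= fE
  (henon_like_bounded_orbit _ a1 b1 N1 _ d1 gap).
Qed.

Lemma paramHI_Jminus (d : R) : 1 < d -> (forall x, 1 < v x -> d <= v x) ->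
  paramHI v ab -> Jminus v ab = unit_ball v.
Proof.
move=> d1 gap [_ a1 b1]; apply/seteqP.
have bV1 : v ab.2^-1 = 1 by rewrite absvV// b1 invr1.
have ba1 : v (ab.2^-1 * - ab.1) <= 1 by rewrite absvM bV1 mul1r absvN.
have gE z : henon_inv ab (swap_pair z) =
    swap_pair (henon_like (ab.2^-1 * - ab.1) ab.2^-1 ab.2^-1 z).
  by rewrite /henon_inv /henon_like /swap_pair /= !mulrDr.
have iffJ z : Jminus v ab z <-> unit_ball v z.
  have -> : z = swap_pair (swap_pair z) by case: z.
  rewrite /Jminus /= (bounded_orbit_swap _ _ gE).
  rewrite (henon_like_bounded_orbit _ ba1 bV1 bV1 _ d1 gap).
  by rewrite /unit_ball /max_norm /= maxC.
by split=> z /iffJ.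
Qed.

End Orbits.

Theorem theorem3p9 (R : realType) (K : fieldType) (v : nonarchAbs R K)
  (v_nontrivial : nontrivial_abs v)
  (v_complete : complete_abs v)
  (v_locally_compact : locally_compact_abs v)
  (v_odd_residue_char : odd_residue_char v)
  (a b : K) (abH : paramH (a, b)) :
  [<-> paramHI v (a, b);
       Jset v (a, b) = unit_ball v;
       Jplus v (a, b) = unit_ball v;
       Jminus v (a, b) = unit_ball v;
       henon (a, b) @` unit_ball v = unit_ball v].
Proof.
have [d d1 gap] := absv_gap v v_nontrivial v_locally_compact.
have image_HI (A : set (K * K)) :
    henon (a, b) @` A = A -> A = unit_ball v -> paramHI v (a, b).
  by move=> fA AB; apply: image_unit_ball_paramHI => //; rewrite -AB.
have Jp := paramHI_Jplus v d d1 gap; have Jm := paramHI_Jminus v abH d d1 gap.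
(* The implications form a cycle; those from J to J+ and from J+ to J- pass through the parameter
   condition. *)
tfae.
- by move=> HI; rewrite /Jset Jp// Jm// setIid.
- by move=> /(image_HI _ (henon_image_Jset v abH))/Jp.
- by move=> /(image_HI _ (henon_image_Jplus v abH))/Jm.
- by move=> JB; rewrite -JB henon_image_Jminus.
- exact: image_unit_ball_paramHI.
Qed.
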